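(* There do not exist universal constants $c_1,c_2>0$ such that for every bounded, $C^\infty$, simply connected, nonconvex planar domain $\Omega\subset\mathbb R^2$, with $u$ the solution of $-\Delta u=1$ in $\Omega$, $u=0$ on $\partial\Omega$, and every global maximizer $y_0\in\Omega$ of $u$, one has \[ \lambda_{\max}\bigl(D^2u(y_0)\bigr)\le -c_1\exp\left(-c_2\,\frac{\operatorname{diam}(\Omega)}{\operatorname{inrad}(\Omega)}\right). \]
   Context: $\lambda_{\max}(M)$ is the largest eigenvalue of a symmetric matrix $M$; $\operatorname{inrad}(\Omega)$ is the inradius (supremum of radii of disks contained in $\Omega$). *)

(* Defs.v *)
From HB Require Import structures.
From mathcomp Require Import all_boot all_order all_algebra.
From mathcomp Require Import all_classical all_reals all_analysis.
Import Order.TTheory GRing.Theory Num.Theory.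
Import numFieldNormedType.Exports.

Set Implicit Arguments.
Unset Strict Implicit.
Unset Printing Implicit Defensive.

Local Open Scope classical_set_scope.
Local Open Scope ring_scope.

(* The library norm and balls on 'rV[R]_2 are those of the sup norm. They give
   the usual topology and bounded sets, but the diameter and the inradius need
   the Euclidean norm. *)
Definition enorm (R : realType) (x : 'rV[R]_2) : R :=
  Num.sqrt (\sum_(i < 2) x 0 i ^+ 2).

Definition disk (R : realType) (x : 'rV[R]_2) (r : R) : set 'rV[R]_2 :=
  [set y | enorm (y - x) < r].

Definition diam (R : realType) (A : set 'rV[R]_2) : R :=
  sup [set d | exists x y, [/\ A x, A y & d = enorm (x - y)]].

Definition inrad (R : realType) (A : set 'rV[R]_2) : R :=
  sup [set r | 0 < r /\ exists x, disk x r `<=` A].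

Definition boundary (T : topologicalType) (A : set T) : set T :=
  closure A `\` A°.

Definition partial (R : realType) (i : 'I_2) (f : 'rV[R]_2 -> R) :
    'rV[R]_2 -> R :=
  fun x => 'D_(delta_mx 0 i) f x.

(* f is of class C^k on the open set U; values of f outside U are irrelevant. *)
Fixpoint Ck_on (R : realType) (k : nat) (U : set 'rV[R]_2)
    (f : 'rV[R]_2 -> R) : Prop :=
  (forall x, U x -> {for x, continuous f}) /\
  if k is k'.+1 then
    forall i : 'I_2,
      (forall x, U x -> derivable f x (delta_mx 0 i)) /\
      Ck_on k' U (partial i f)
  else True.

Definition smooth_on (R : realType) (U : set 'rV[R]_2)
    (f : 'rV[R]_2 -> R) : Prop :=
  forall k, Ck_on k U f.

Definition hessian (R : realType) (f : 'rV[R]_2 -> R) (x : 'rV[R]_2) :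
    'M[R]_2 :=
  \matrix_(i, j) partial i (partial j f) x.

Definition laplacian (R : realType) (f : 'rV[R]_2 -> R) (x : 'rV[R]_2) : R :=
  \sum_(i < 2) partial i (partial i f) x.

(* For symmetric M the set of real eigenvalues is finite and nonempty, so the
   supremum is attained. *)
Definition lambda_max (R : realType) (n : nat) (M : 'M[R]_n) : R :=
  sup [set a | eigenvalue M a].

Definition planar_domain (R : realType) (A : set 'rV[R]_2) : Prop :=
  [/\ open A, connected A & A !=set0].

(* C^oo boundary, by local defining functions: near each boundary point the set
   is a strict sublevel set, and its boundary the zero level set, of a smooth
   function without critical points. In particular the set lies locally on one
   side of its boundary. *)
Definition smooth_boundary (R : realType) (A : set 'rV[R]_2) : Prop :=
  forall p, boundary A p ->
    exists (V : set 'rV[R]_2) (phi : 'rV[R]_2 -> R),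
      [/\ open V, V p, smooth_on V phi,
          forall x, V x -> exists i, partial i phi x != 0 &
          forall x, V x ->
            (A x <-> phi x < 0) /\ (boundary A x <-> phi x = 0)].

Definition path_in (R : realType) (A : set 'rV[R]_2) (g : R -> 'rV[R]_2) :
    Prop :=
  {within `[0, 1], continuous g} /\ forall t, 0 <= t <= 1 -> A (g t).

(* The homotopy H (s, t) is based: s is the deformation parameter and t the
   parameter along the loops. *)
Definition null_homotopic (R : realType) (A : set 'rV[R]_2)
    (g : R -> 'rV[R]_2) : Prop :=
  exists H : R * R -> 'rV[R]_2,
    [/\ {within `[0, 1] `*` `[0, 1], continuous H},
        forall s t, 0 <= s <= 1 -> 0 <= t <= 1 -> A (H (s, t)),
        forall t, 0 <= t <= 1 -> H (0, t) = g t,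
        forall t, 0 <= t <= 1 -> H (1, t) = g 0 &
        forall s, 0 <= s <= 1 -> H (s, 0) = g 0 /\ H (s, 1) = g 0].

Definition simply_connected (R : realType) (A : set 'rV[R]_2) : Prop :=
  (forall x y, A x -> A y ->
     exists g : R -> 'rV[R]_2, [/\ path_in A g, g 0 = x & g 1 = y]) /\
  (forall g : R -> 'rV[R]_2, path_in A g -> g 0 = g 1 -> null_homotopic A g).

(* u is the classical solution of - Laplacian u = 1 in A, u = 0 on the boundary
   of A; values of u outside the closure of A are irrelevant. *)
Definition torsion_function (R : realType) (A : set 'rV[R]_2)
    (u : 'rV[R]_2 -> R) : Prop :=
  [/\ Ck_on 2 A u,
      {within closure A, continuous u},
      forall x, A x -> - laplacian u x = 1 &
      forall x, boundary A x -> u x = 0].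

Definition global_maximizer (R : realType) (A : set 'rV[R]_2)
    (u : 'rV[R]_2 -> R) (y0 : 'rV[R]_2) : Prop :=
  A y0 /\ forall x, A x -> u x <= u y0.

(* Main.v *)
Require Import Defs.
From HB Require Import structures.
From mathcomp Require Import all_boot all_order all_algebra.
From mathcomp Require Import all_classical all_reals all_analysis.
From mathcomp Require Import ring lra.
Import Order.TTheory GRing.Theory Num.Theory.
Import numFieldNormedType.Exports.

Local Open Scope classical_set_scope.
Local Open Scope ring_scope.

(** The asserted bound is strictly negative for every choice of the constants,
    so a single nonconvex domain whose torsion function has a degenerate maximum
    refutes it. The one-dimensional profile c - y^2/2 is degenerate along the x
    axis; subtracting the harmonic polynomial
    a Re((x + iy)^4) = a (x^4 - 6 x^2 y^2 + y^4) keeps the Laplacian and the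
    Hessian at the origin, and makes u decrease along the x axis as well. With
    a = 1/100 and c = 51/100 the function is

      u = (51 - 50 y^2 - x^4 + 6 x^2 y^2 - y^4) / 100.

    The set {u > 0} also has unbounded components around the diagonals, where
    the quartic is negative. On x^2 = 8 one has u < 0, so the strip x^2 < 8 cuts
    out the component of the origin, and only the curve u = 0 contributes to its
    boundary ([height_strip], [boundary_peanut]). In the strip the coefficient
    50 - 6 x^2 of - y^2 is positive; this makes the origin a global maximizer
    and the gradient nonzero elsewhere ([smooth_boundary_peanut]). The term
    6 x^2 y^2 thickens the set on both sides of the y axis: the points (1, 1)
    and (-1, 1) belong to it and their midpoint (0, 1) is on the boundary
    ([nonconvex_peanut]).

    Topology comes from star-shapedness: u increases strictly when a point of
    the closed domain moves straight towards the origin ([height_radial]), and a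
    star-shaped set is connected and simply connected. *)

(** Splits on the innermost minima and maxima first, so that every comparison
    handed to lra is between linear expressions. *)
Ltac minmax_lra :=
  repeat match goal with
  | |- context [Num.min ?a ?b] =>
    lazymatch constr:((a, b)) with
    | context [Num.min _ _] => fail
    | _ => case: (leP a b) => ?
    end
  | |- context [Num.max ?a ?b] =>
    lazymatch constr:((a, b)) with
    | context [Num.min _ _] => fail
    | _ => case: (leP a b) => ?
    end
  end; lra.

(** * Star-shaped sets *)

Definition star_shaped (R : realType) (A : set 'rV[R]_2) : Prop :=
  forall x t, A x -> 0 <= t <= 1 -> A (t *: x).

Definition clamp (R : realType) (x : R) : R := Num.max 0 (Num.min 1 x).

Lemma clamp_itv (R : realType) (x : R) : 0 <= clamp R x <= 1.
Proof.
by rewrite /clamp; apply/andP; split; minmax_lra.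
Qed.

Lemma clamp_id (R : realType) (x : R) : 0 <= x <= 1 -> clamp R x = x.
Proof. by rewrite /clamp => /andP[? ?]; minmax_lra. Qed.

Lemma clamp_le0 (R : realType) (x : R) : x <= 0 -> clamp R x = 0.
Proof. by rewrite /clamp => h; minmax_lra. Qed.

Lemma clamp_ge1 (R : realType) (x : R) : 1 <= x -> clamp R x = 1.
Proof. by rewrite /clamp => h; minmax_lra. Qed.

Lemma continuous_clamp (R : realType) : continuous (clamp R).
Proof.
move=> x; apply: (@continuous_max R R (fun=> 0) (fun x => Num.min 1 x)).
  exact: cvg_cst.
by apply: (@continuous_min R R (fun=> 1) id); [exact: cvg_cst|exact: cvg_id].
Qed.

Lemma cvg_clamp (R : realType) (T : Type) (F : set_system T) (f : T -> R)
    (l : R) :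
  f @ F --> l -> clamp R (f x) @[x --> F] --> clamp R l.
Proof. by move=> fl; apply: (cvg_comp _ _ fl); exact: continuous_clamp. Qed.

(** Precomposing with the clamp extends a path on [0, 1] to a continuous function
    on the line, so that the homotopy below is continuous as a composition. *)
Lemma continuous_comp_clamp (R : realType) (T : topologicalType) (g : R -> T) :
  {within `[0, 1], continuous g} -> continuous (g \o clamp R).
Proof.
move=> /subspace_continuousP gc x.
have cx : `[0, 1]%classic (clamp R x) by rewrite /= in_itv /= clamp_itv.
move=> U /(gc _ cx); rewrite /fmap /within /= => nU.
apply: (@filterS _ (nbhs x) _ _ _ _ (continuous_clamp R x _ nU)) => y /=.
by apply; rewrite in_itv /= clamp_itv.
Qed.

(** The path runs from x to the center and then to y; at each time one of the
    two summands vanishes. *)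
Lemma star_shaped_path (R : realType) (A : set 'rV[R]_2) (x y : 'rV[R]_2) :
  star_shaped R A -> A x -> A y ->
  exists g : R -> 'rV[R]_2, [/\ path_in A g, g 0 = x & g 1 = y].
Proof.
move=> sA Ax Ay.
exists (fun t => clamp R (1 - 2 * t) *: x + clamp R (2 * t - 1) *: y).
split; [split| |].
- apply: continuous_subspaceT => u; apply: cvgD; apply: cvgZr_tmp.
    apply: cvg_clamp; apply: cvgB; first exact: cvg_cst.
    by apply: cvgM; [exact: cvg_cst|exact: cvg_id].
  apply: cvg_clamp; apply: cvgB; last exact: cvg_cst.
  by apply: cvgM; [exact: cvg_cst|exact: cvg_id].
- move=> t t01; have [h|h] := leP (2 * t) 1.
    rewrite (clamp_le0 _ (2 * t - 1)); last lra.
    by rewrite scale0r addr0; apply: sA => //; exact: clamp_itv.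
  rewrite (clamp_le0 _ (1 - 2 * t)); last lra.
  by rewrite scale0r add0r; apply: sA => //; exact: clamp_itv.
- rewrite clamp_ge1; last lra.
  by rewrite clamp_le0 ?scale1r ?scale0r ?addr0 //; lra.
- rewrite clamp_le0; last lra.
  by rewrite clamp_ge1 ?scale1r ?scale0r ?add0r //; lra.
Qed.

Lemma star_shaped_connected (R : realType) (A : set 'rV[R]_2) :
  star_shaped R A -> connected A.
Proof.
move=> sA.
have -> : A = \bigcup_(x in A) [set t *: x | t in `[0 : R, 1]].
  apply/seteqP; split => [x Ax|y [x Ax [t /=]]].
    by exists x => //; exists 1; rewrite ?scale1r //= in_itv /= ler01 lexx.
  by rewrite in_itv /= => t01 <-; exact: sA.
apply: bigcup_connected.
  by exists 0 => x _; exists 0; rewrite ?scale0r //= in_itv /= ler01 lexx.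
move=> x _; apply: connected_continuous_connected; first exact: segment_connected.
by apply: continuous_subspaceT; exact: scalel_continuous.
Qed.

(** Shrinking the loop to the center moves its base point p = g 0. The loop is
    therefore preceded and followed by the segment from p towards the center:
    for s <= 1/2 the loop becomes the segment from p to (1 - 2 s) p, then
    (1 - 2 s) g, then the segment back. At s = 1/2 only the segment from p to
    the center and back is left, and for s >= 1/2 it is retracted to p. *)
Lemma star_shaped_null_homotopic (R : realType) (A : set 'rV[R]_2)
    (g : R -> 'rV[R]_2) :
  star_shaped R A -> path_in A g -> g 0 = g 1 -> null_homotopic A g.
Proof.
move=> sA [gc gA] g01.
(* tau runs through the loop; at s = 1/2 it does so for t in [1/3, 2/3], where
   v = 1. Both a and b scale the point; they agree for s <= 1/2. *)
pose v (t : R) := Num.min 1 (Num.min (3 * t) (3 - 3 * t)).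
pose tau (s t : R) := clamp R ((1 + 2 * clamp R (2 * s)) * t - clamp R (2 * s)).
pose a (s t : R) := 1 - Num.min (v t) (2 * s).
pose b (s t : R) := 1 - Num.min (v t) (Num.min (2 * s) (2 - 2 * s)).
have v0 : v 0 = 0.
  by rewrite /v; minmax_lra.
have v1 : v 1 = 0.
  by rewrite /v; minmax_lra.
have v01 t : 0 <= t <= 1 -> 0 <= v t <= 1.
  by move=> /andP[? ?]; apply/andP; rewrite /v; split; minmax_lra.
have b01 s t : 0 <= s <= 1 -> 0 <= t <= 1 -> 0 <= b s t <= 1.
  move=> /andP[? ?] /v01/andP[? ?]; apply/andP; rewrite /b.
  by split; minmax_lra.
(* For s >= 1/2, either a = 0 or tau is at an end of the loop, where g is p. *)
have late s t : 1 <= 2 * s -> a s t *: (g (tau s t) - g 0) = 0.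
  move=> s2; have cs : clamp R (2 * s) = 1 by exact: clamp_ge1.
  rewrite /tau cs; have [t3|t3] := leP (3 * t) 1.
    by rewrite clamp_le0 ?subrr ?scaler0 //; lra.
  have [t3'|t3'] := leP 2 (3 * t).
    by rewrite clamp_ge1 -?g01 ?subrr ?scaler0 //; lra.
  suff -> : a s t = 0 by rewrite scale0r.
  by rewrite /a /v; minmax_lra.
have early s t : 2 * s <= 1 -> a s t = b s t.
  by move=> s2; rewrite /a /b; minmax_lra.
exists (fun z => a z.1 z.2 *: (g (tau z.1 z.2) - g 0) + b z.1 z.2 *: g 0).
have cont_min (f h : R * R -> R) :
    continuous f -> continuous h -> continuous (fun z => Num.min (f z) (h z)).
  by move=> cf ch z; apply: (continuous_min (cf z) (ch z)).
have c2s : continuous (fun z : R * R => 2 * z.1).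
  by move=> z; apply: cvgM; [exact: cvg_cst|exact: cvg_fst].
have c3t : continuous (fun z : R * R => 3 * z.2).
  by move=> z; apply: cvgM; [exact: cvg_cst|exact: cvg_snd].
have c1B (c : R) (f : R * R -> R) : continuous f -> continuous (fun z => c - f z).
  by move=> cf z; apply: cvgB; [exact: cvg_cst|exact: cf].
have cv : continuous (fun z : R * R => v z.2).
  apply: (cont_min); first by move=> z; exact: cvg_cst.
  by apply: (cont_min) => //; exact: c1B.
have cc : continuous (fun z : R * R => clamp R (2 * z.1)).
  by move=> z; apply: cvg_clamp; exact: (c2s z).
have ctau : continuous (fun z : R * R =>
    (1 + 2 * clamp R (2 * z.1)) * z.2 - clamp R (2 * z.1)).
  move=> z; apply: cvgB; last exact: (cc z).
  apply: cvgM; last exact: cvg_snd.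
  apply: cvgD; first exact: cvg_cst.
  by apply: cvgM; [exact: cvg_cst|exact: (cc z)].
have cg := continuous_comp_clamp R _ g gc.
split.
- apply: continuous_subspaceT => z; apply: cvgD; last first.
    apply: cvgZr_tmp; apply: (c1B 1); apply: (cont_min) => //.
    by apply: (cont_min) => //; exact: c1B.
  apply: cvgZ; first by apply: (c1B 1); exact: (cont_min).
  apply: cvgB; last exact: cvg_cst.
  exact: (continuous_comp (ctau z) (cg _)).
- move=> s t s01 t01 /=; have [s2|/ltW s2] := leP (2 * s) 1.
    rewrite early // -scalerDr subrK; apply: sA; last exact: b01.
    exact/gA/clamp_itv.
  by rewrite late // add0r; apply: sA; [apply: gA; rewrite lexx ler01|exact: b01].
- move=> t t01 /=; rewrite early; last lra.
  have -> : b 0 t = 1.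
    have /andP[? ?] := v01 t t01.
    by rewrite /b; minmax_lra.
  rewrite -scalerDr subrK scale1r /tau (clamp_le0 _ (2 * 0)); last lra.
  by rewrite clamp_id; [congr g; ring|rewrite mulr0 addr0 mul1r subr0].
- move=> t t01 /=; rewrite late; last lra.
  have -> : b 1 t = 1.
    have /andP[? ?] := v01 t t01.
    by rewrite /b; minmax_lra.
  by rewrite scale1r add0r.
- move=> s /andP[s0 s1] /=.
  have cs := clamp_itv R (2 * s); move/andP: cs => [cs0 cs1].
  have [a0 b0] : a s 0 = 1 /\ b s 0 = 1.
    by rewrite /a /b v0; split; minmax_lra.
  have [a1 b1] : a s 1 = 1 /\ b s 1 = 1.
    by rewrite /a /b v1; split; minmax_lra.
  rewrite a0 b0 a1 b1 !scale1r !subrK; split; first by rewrite /tau clamp_le0 //; lra.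
  by rewrite g01 /tau clamp_ge1 //; lra.
Qed.

Lemma star_shaped_simply_connected (R : realType) (A : set 'rV[R]_2) :
  star_shaped R A -> simply_connected A.
Proof.
move=> sA; split => [x y|g]; first exact: star_shaped_path.
exact: star_shaped_null_homotopic.
Qed.

(** * Polynomial functions of two variables *)

(** A syntax for polynomials is closed under formal differentiation, so iterated
    partial derivatives reduce by computation. *)
Inductive bipoly (R : Type) : Type :=
| Const of R
| Coord of 'I_2
| Add of bipoly R & bipoly R
| Mul of bipoly R & bipoly R.

Arguments Const {R}.
Arguments Coord {R}.
Arguments Add {R}.
Arguments Mul {R}.

Fixpoint beval (R : realType) (p : bipoly R) (x : 'rV[R]_2) : R :=
  match p with
  | Const c => c
  | Coord i => x 0 i
  | Add p q => beval R p x + beval R q x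
  | Mul p q => beval R p x * beval R q x
  end.

Fixpoint bderiv (R : realType) (i : 'I_2) (p : bipoly R) : bipoly R :=
  match p with
  | Const _ => Const 0
  | Coord j => Const (i == j)%:R
  | Add p q => Add (bderiv R i p) (bderiv R i q)
  | Mul p q => Add (Mul p (bderiv R i q)) (Mul q (bderiv R i p))
  end.

Lemma is_derive_coord (R : realType) (x v : 'rV[R]_2) (j : 'I_2) :
  is_derive x v (fun y : 'rV[R]_2 => y 0 j) (v 0 j).
Proof.
have did : derivable (@id 'rV[R]_2) x v by exact: derivable_id.
apply: DeriveDef; first by move/derivable_mxP: did; apply.
by rewrite -[in RHS](derive_id x v) (derive_mx did) mxE.
Qed.

Lemma is_derive_beval (R : realType) (i : 'I_2) (p : bipoly R) (x : 'rV[R]_2) :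
  is_derive x (delta_mx 0 i) (beval R p) (beval R (bderiv R i p) x).
Proof.
elim: p => [c|j|p ihp q ihq|p ihp q ihq] /=.
- exact: is_derive_cst.
- have := is_derive_coord R x (delta_mx 0 i) j.
  by rewrite mxE eqxx /= eq_sym.
- exact: is_deriveD.
- exact: is_deriveM.
Qed.

Lemma partial_beval (R : realType) (i : 'I_2) (p : bipoly R) :
  partial i (beval R p) = beval R (bderiv R i p).
Proof.
by apply/funext => x; exact: (derive_val (is_derive := is_derive_beval _ i p x)).
Qed.

Lemma continuous_beval (R : realType) (p : bipoly R) : continuous (beval R p).
Proof.
elim: p => [c|j|p ihp q ihq|p ihp q ihq] x.
- exact: (@cst_continuous _ _ c x).
- exact: (@coord_continuous _ _ _ 0 j x).
- exact: (cvgD (ihp x) (ihq x)).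
- exact: (cvgM (ihp x) (ihq x)).
Qed.

Lemma smooth_on_beval (R : realType) (U : set 'rV[R]_2) (p : bipoly R) :
  smooth_on U (beval R p).
Proof.
move=> k; elim: k p => [|k ih] p; split=> //.
- by move=> x _; exact: continuous_beval.
- by move=> x _; exact: continuous_beval.
- move=> i; split => [x _|]; last by rewrite partial_beval; exact: ih.
  by have [] := is_derive_beval R i p x.
Qed.

(** * Estimates in the strip *)

Definition height (R : realType) (x y : R) : R :=
  (51 - 50 * y ^+ 2 - (x ^+ 4 - 6 * x ^+ 2 * y ^+ 2 + y ^+ 4)) / 100.

Lemma height_max (R : realType) (x y : R) :
  x ^+ 2 <= 8 -> height R x y <= height R 0 0.
Proof.
rewrite /height => x8; have := sqr_ge0 y; have := sqr_ge0 x.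
set X := x ^+ 2 in x8 *; set Y := y ^+ 2.
have -> : x ^+ 4 = X ^+ 2 by rewrite -exprM.
have -> : y ^+ 4 = Y ^+ 2 by rewrite -exprM.
nra.
Qed.

(** At x^2 = 8 the numerator is - 13 - 2 y^2 - y^4. *)
Lemma height_strip (R : realType) (x y : R) :
  x ^+ 2 <= 8 -> 0 <= height R x y -> x ^+ 2 < 8 /\ y ^+ 2 <= 8.
Proof.
rewrite /height; have := sqr_ge0 y; have := sqr_ge0 x.
set X := x ^+ 2; set Y := y ^+ 2.
have -> : x ^+ 4 = X ^+ 2 by rewrite -exprM.
have -> : y ^+ 4 = Y ^+ 2 by rewrite -exprM.
move=> X0 Y0 X8 h; split; first by rewrite lt_neqAle X8 andbT; apply/eqP; nra.
nra.
Qed.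

(** With X = x^2, Y = y^2 and T = t^2, the numerator at (t x, t y) is
    51 - 50 T Y - T^2 (X^2 - 6 X Y + Y^2), and the claim is that minus half its
    derivative at T = 1 is nonnegative. Completing the square, the quadratic form is
    (X - 3 Y)^2 - 8 Y^2, so only Y > 25/8 could be harmful. In that range
    3 Y - X >= 3 Y - 8 > 0, which pushes the constraint above
    Y^2 + 2 Y + 64 > 51. *)
Lemma radial_derivative_ge0 (R : realType) (X Y : R) :
  0 <= X -> X <= 8 -> 0 <= Y -> 50 * Y + X ^+ 2 - 6 * X * Y + Y ^+ 2 <= 51 ->
  0 <= 25 * Y + (X ^+ 2 - 6 * X * Y + Y ^+ 2).
Proof.
move=> X0 X8 Y0 h; have [Y3|Y3] := leP Y (25 / 8).
  by have := sqr_ge0 (X - 3 * Y); nra.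
have : (3 * Y - 8) ^+ 2 <= (3 * Y - X) ^+ 2 by nra.
nra.
Qed.

(** The difference of the two heights is (1 - T) (50 Y + (1 + T) q) / 100, with
    q the quadratic form. The second factor is (1 - T) 25 Y + (1 + T) (25 Y + q),
    which is positive for Y > 0 and equals (1 + T) X^2 for Y = 0. *)
Lemma height_radial (R : realType) (x y t : R) :
  x ^+ 2 <= 8 -> 0 <= height R x y -> (x != 0) || (y != 0) -> 0 <= t < 1 ->
  height R x y < height R (t * x) (t * y).
Proof.
rewrite /height !exprMn -(sqrf_eq0 x) -(sqrf_eq0 y).
have := sqr_ge0 y; have := sqr_ge0 x.
set X := x ^+ 2; set Y := y ^+ 2.
have -> : x ^+ 4 = X ^+ 2 by rewrite -exprM.
have -> : y ^+ 4 = Y ^+ 2 by rewrite -exprM.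
have -> : t ^+ 4 = (t ^+ 2) ^+ 2 by rewrite -exprM.
move=> X0 Y0 X8 h xy0 /andP[t0 t1].
have : 0 <= t ^+ 2 < 1 by rewrite sqr_ge0 /= expr_lt1.
move: (t ^+ 2) => T /andP[T0 T1].
have k := radial_derivative_ge0 R X Y X0 X8 Y0 ltac:(lra).
set q := X ^+ 2 - 6 * X * Y + Y ^+ 2 in k.
suff k2 : 0 < 50 * Y + (1 + T) * q.
  rewrite -subr_gt0.
  rewrite (_ : _ - _ = (1 - T) * (50 * Y + (1 + T) * q) / 100).
    by rewrite divr_gt0 // mulr_gt0 // subr_gt0.
  by rewrite /q; field.
have [Y00|Ypos] := leP Y 0.
  have Ye : Y = 0 by lra.
  move: xy0; rewrite {1}Ye eqxx orbF => Xn0.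
  have Xp : 0 < X by rewrite lt_neqAle eq_sym Xn0.
  rewrite /q Ye; have : 0 < X ^+ 2 by rewrite exprn_gt0.
  nra.
nra.
Qed.

(** * The domain *)

Definition torsion_poly (R : realType) : bipoly R :=
  let X := Coord 0 in
  let Y := Coord 1 in
  let X2 := Mul X X in
  let Y2 := Mul Y Y in
  Add (Const (51 / 100))
    (Add (Mul (Const (- (1 / 2))) Y2)
      (Mul (Const (- (1 / 100)))
        (Add (Mul X2 X2) (Add (Mul (Const (- 6)) (Mul X2 Y2)) (Mul Y2 Y2))))).

Definition torsion (R : realType) : 'rV[R]_2 -> R := beval R (torsion_poly R).

Definition peanut (R : realType) : set 'rV[R]_2 :=
  [set x | 0 < torsion R x /\ x 0 0 ^+ 2 < 8].

Lemma torsionE (R : realType) (x : 'rV[R]_2) :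
  torsion R x = height R (x 0 0) (x 0 1).
Proof. by rewrite /torsion /height /=; field. Qed.

Lemma I2P (i : 'I_2) : i = 0 \/ i = 1.
Proof. by case: i => -[|[|//]] h; [left|right]; exact: val_inj. Qed.

Lemma sum2 (R : realType) (f : 'I_2 -> R) : \sum_i f i = f 0 + f 1.
Proof.
rewrite !big_ord_recl big_ord0 addr0; congr (_ + f _); exact: val_inj.
Qed.

Lemma row2_neq0 (R : realType) (x : 'rV[R]_2) :
  x != 0 -> (x 0 0 != 0) || (x 0 1 != 0).
Proof.
move=> x0; rewrite -negb_and; apply: contraNN x0 => /andP[/eqP h0 /eqP h1].
by apply/eqP/rowP => i; rewrite mxE; case: (I2P i) => ->.
Qed.

Lemma torsion_radial (R : realType) (x : 'rV[R]_2) (t : R) :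
  x 0 0 ^+ 2 <= 8 -> 0 <= torsion R x -> x != 0 -> 0 <= t < 1 ->
  torsion R x < torsion R (t *: x).
Proof.
by rewrite !torsionE !mxE => x8 u0 /row2_neq0; exact: height_radial.
Qed.

Lemma torsion0 (R : realType) : torsion R 0 = 51 / 100.
Proof. by rewrite torsionE !mxE /height; field. Qed.

Lemma peanut0 (R : realType) : peanut R 0.
Proof. by split; rewrite ?torsion0 ?mxE ?expr0n //=; lra. Qed.

Lemma scale_strip (R : realType) (x t : R) :
  0 <= t <= 1 -> x ^+ 2 < 8 -> (t * x) ^+ 2 < 8.
Proof.
move=> /andP[t0 t1] x8; rewrite exprMn.
by have := sqr_ge0 x; have : t ^+ 2 <= 1 by [rewrite expr_le1]; nra.
Qed.

Lemma peanut_star_shaped (R : realType) : star_shaped R (peanut R).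
Proof.
move=> x t [u0 x8] t01; split; last by rewrite mxE; exact: scale_strip.
have [->|x0] := eqVneq x 0; first by rewrite scaler0 torsion0; lra.
have [t1|t1] := leP 1 t.
  by have -> : t = 1; [lra|rewrite scale1r].
apply: (lt_trans u0); apply: torsion_radial => //; [exact: ltW|exact: ltW|].
by apply/andP; split => //; case/andP: t01.
Qed.

Lemma continuous_torsion (R : realType) : continuous (torsion R).
Proof. exact: continuous_beval. Qed.

Lemma continuous_sqr_coord (R : realType) :
  continuous (fun x : 'rV[R]_2 => x 0 0 ^+ 2).
Proof. exact: (continuous_beval R (Mul (Coord 0) (Coord 0))). Qed.

Lemma open_strip (R : realType) : open [set x : 'rV[R]_2 | x 0 0 ^+ 2 < 8].
Proof.
apply: (@open_comp _ _ (fun x : 'rV[R]_2 => x 0 0 ^+ 2) [set y | y < 8]).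
  by move=> x _; exact: continuous_sqr_coord.
exact: open_lt.
Qed.

Lemma open_peanut (R : realType) : open (peanut R).
Proof.
apply: openI; last exact: open_strip.
apply: (@open_comp _ _ (torsion R) [set y | 0 < y]).
  by move=> x _; exact: continuous_torsion.
exact: open_gt.
Qed.

Lemma closure_sub_closed (T : topologicalType) (A C : set T) :
  closed C -> A `<=` C -> closure A `<=` C.
Proof. by move=> /closure_id cC AC; rewrite cC; exact: closureS. Qed.

(** A zero of u in the strip is a limit of points of the domain because u is
    positive on the open segment from it to the origin. *)
Lemma boundary_peanut (R : realType) (x : 'rV[R]_2) :
  boundary (peanut R) x <-> torsion R x = 0 /\ x 0 0 ^+ 2 < 8.
Proof.
have -> : boundary (peanut R) = closure (peanut R) `\` peanut R.
  by rewrite /boundary ((interior_id _).1 (open_peanut R)).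
split=> [[cx nx]|[u0 x8]].
  have u0 : 0 <= torsion R x.
    apply: (@closure_sub_closed _ _ (torsion R @^-1` [set y | 0 <= y]) _ _ x cx).
      exact: ((continuous_closedP _).1 (continuous_torsion R) _ (@closed_ge R 0)).
    by move=> y [/ltW].
  have x8 : x 0 0 ^+ 2 <= 8.
    apply: (@closure_sub_closed _ _
      ((fun x : 'rV[R]_2 => x 0 0 ^+ 2) @^-1` [set y | y <= 8]) _ _ x cx).
      exact: ((continuous_closedP _).1 (continuous_sqr_coord R) _ (@closed_le R 8)).
    by move=> y [_ /ltW].
  have [x8' _] : x 0 0 ^+ 2 < 8 /\ x 0 1 ^+ 2 <= 8.
    by apply: height_strip => //; rewrite -torsionE.
  split=> //; apply/eqP; rewrite eq_le u0 andbT leNgt; apply/negP => up.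
  exact: nx.
split; last by move=> [+ _]; rewrite u0 ltxx.
have x0 : x != 0.
  by apply/eqP => x0; move: u0; rewrite x0 torsion0; lra.
move=> B nB.
have nB' : \forall t \near (1 : R), B (t *: x).
  have h : (t *: x) @[t --> (1 : R)] --> x.
    by rewrite -[X in _ --> X]scale1r; exact: scalel_continuous.
  exact: h nB.
have /nbhs_ballP[e /= e0 he] := nB'.
pose t := Num.max (1 / 2) (1 - e / 2).
have [t0 t1 te] : [/\ 0 <= t, t < 1 & 1 - t < e].
  by rewrite /t; split; minmax_lra.
exists (t *: x); split.
  split; last by rewrite mxE; apply: scale_strip => //; rewrite t0 ltW.
  by have := torsion_radial R x t (ltW x8); rewrite u0 t0 t1; apply.
apply: he; rewrite /ball /= ger0_norm //; lra.
Qed.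

(** One defining function, - u, serves all boundary points, on the strip
    without the origin. There u_y = - y (50 - 6 x^2 + 2 y^2) / 50 vanishes only
    on the x axis, where u_x = - x^3 / 25. *)
Lemma smooth_boundary_peanut (R : realType) : smooth_boundary (peanut R).
Proof.
move=> p /boundary_peanut [up p8].
(* The condition u x < u 0 is an open one that excludes the origin. *)
exists [set x : 'rV[R]_2 | x 0 0 ^+ 2 < 8 /\ torsion R x < torsion R 0].
exists (beval R (Mul (Const (- 1)) (torsion_poly R))).
have E (x : 'rV[R]_2) : beval R (Mul (Const (- 1)) (torsion_poly R)) x = - torsion R x.
  by rewrite /= mulN1r.
split.
- apply: openI; first exact: open_strip.
  apply: (@open_comp _ _ (torsion R) [set y | y < torsion R 0]).
    by move=> x _; exact: continuous_torsion.
  exact: open_lt.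
- by split; rewrite // up torsion0; lra.
- exact: smooth_on_beval.
- move=> x [x8 xlt0].
  have [y0|y0] := eqVneq (x 0 1) 0; [exists 0|exists 1];
      rewrite partial_beval /=; apply/eqP => d0.
    have x0 : x 0 0 = 0.
      have /eqP : x 0 0 ^+ 3 = 0 by move: d0; rewrite y0; lra.
      by rewrite expf_eq0 => /eqP.
    by move: xlt0; rewrite !torsionE !mxE x0 y0 ltxx.
  have : x 0 1 * (50 - 6 * x 0 0 ^+ 2 + 2 * x 0 1 ^+ 2) = 0 by lra.
  move/eqP; rewrite mulf_eq0 (negbTE y0) /= => /eqP.
  by have := sqr_ge0 (x 0 1); lra.
- move=> x [x8 _]; rewrite E oppr_lt0; split; first by split=> [[]|].
  by rewrite boundary_peanut; split=> [[-> _]|/eqP]; rewrite ?oppr0 // oppr_eq0 => /eqP.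
Qed.

Lemma bounded_peanut (R : realType) : bounded_set (peanut R).
Proof.
exists 3; split; first exact: num_real.
move=> M M3 x [u0 x8] /=.
have [_ y8] : x 0 0 ^+ 2 < 8 /\ x 0 1 ^+ 2 <= 8.
  by apply: height_strip; [exact: ltW|rewrite -torsionE ltW].
apply: (@le_trans _ _ 3); last exact: ltW.
rewrite /Num.norm /= mx_normrE; apply: bigmax_le => // -[i j] _ /=.
rewrite (ord1 i) -(@ler_pXn2r _ 2) ?nnegrE // real_normK ?num_real //.
case: (I2P j) => ->; lra.
Qed.

(** On the line y = 1 the numerator is 6 x^2 - x^4, which vanishes at x = 0 and is
    positive at x = 1 and x = - 1. *)
Lemma nonconvex_peanut (R : realType) : ~ convex_set (peanut R).
Proof.
pose P (a : R) : 'rV[R]_2 := \row_j (if j == 0 then a else 1).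
have uP a : torsion R (P a) = (6 * a ^+ 2 - a ^+ 4) / 100.
  by rewrite torsionE !mxE /height /=; field.
have [h0 h1] : 0 <= 1 / 2 :> R /\ 1 / 2 <= 1 :> R by split; lra.
move=> /(_ (P 1) (P (- 1)) (Itv01 h0 h1)).
have P1 : peanut R (P 1) by split; rewrite ?uP ?mxE /=; lra.
have PN : peanut R (P (- 1)) by split; rewrite ?uP ?mxE /=; lra.
rewrite !inE => /(_ P1 PN) [+ _].
have -> : conv (Itv01 h0 h1) (P 1 : convex_lmodType _) (P (- 1)) = P 0.
  by apply/rowP => j; rewrite !mxE /=; case: (j == 0); rewrite /unstable.onem; lra.
by rewrite uP; lra.
Qed.

Lemma torsion_function_peanut (R : realType) :
  torsion_function (peanut R) (torsion R).
Proof.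
split.
- exact: smooth_on_beval.
- by apply: continuous_subspaceT; exact: continuous_torsion.
- move=> x _; rewrite /laplacian sum2 /torsion !partial_beval /=; lra.
- by move=> x /boundary_peanut[].
Qed.

Lemma global_maximizer_peanut (R : realType) :
  global_maximizer (peanut R) (torsion R) 0.
Proof.
split; first exact: peanut0.
by move=> x [_ /ltW x8]; rewrite !torsionE !mxE; exact: height_max.
Qed.

Lemma hessian_torsion0 (R : realType) (i j : 'I_2) :
  hessian (torsion R) 0 i j = - ((i == 1) && (j == 1))%:R.
Proof.
rewrite mxE /torsion !partial_beval.
by case: (I2P i) => ->; case: (I2P j) => -> /=; rewrite !mxE; lra.
Qed.

(** The Hessian at the origin is diag(0, -1): the x axis is a null direction. *)
Lemma lambda_max_torsion0 (R : realType) :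
  0 <= lambda_max (hessian (torsion R) 0).
Proof.
apply: ub_le_sup.
  exists 0 => a /eigenvalueP[v ev v0]; rewrite leNgt; apply/negP => a0.
  move/negP: v0; apply; apply/eqP/rowP => j; rewrite [RHS]mxE.
  have := congr1 (fun w : 'rV[R]_2 => w 0 j) ev.
  rewrite !mxE sum2 !hessian_torsion0 /=.
  case: (I2P j) => -> /=; nra.
apply/eigenvalueP; exists (delta_mx 0 0).
  apply/rowP => j; rewrite scale0r -rowE [LHS]mxE [RHS]mxE hessian_torsion0 /=.
  by rewrite oppr0.
apply/eqP => /rowP/(_ 0); rewrite !mxE !eqxx; apply/eqP; exact: oner_neq0.
Qed.

Theorem mainTheorem2 (R : realType) :
  ~ exists c1 c2 : R, [/\ 0 < c1, 0 < c2 &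
      forall (Omega : set 'rV[R]_2) (u : 'rV[R]_2 -> R) (y0 : 'rV[R]_2),
        planar_domain Omega ->
        bounded_set Omega ->
        smooth_boundary Omega ->
        simply_connected Omega ->
        ~ convex_set Omega ->
        torsion_function Omega u ->
        global_maximizer Omega u y0 ->
        lambda_max (hessian u y0) <=
          - c1 * expR (- c2 * (diam Omega / inrad Omega))].
Proof.
move=> [c1 [c2 [c1_gt0 _ bound]]].
have star := peanut_star_shaped R.
have : lambda_max (hessian (torsion R) 0) <=
    - c1 * expR (- c2 * (diam (peanut R) / inrad (peanut R))).
  apply: bound.
  - by split; [exact: open_peanut|exact: star_shaped_connected|exists 0; exact: peanut0].
  - exact: bounded_peanut.
  - exact: smooth_boundary_peanut.
  - exact: star_shaped_simply_connected.
  - exact: nonconvex_peanut.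
  - exact: torsion_function_peanut.
  - exact: global_maximizer_peanut.
apply/negP; rewrite -ltNge; apply: lt_le_trans (lambda_max_torsion0 R).
by rewrite mulNr oppr_lt0 mulr_gt0 // expR_gt0.
Qed.
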